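(* Let $0<t_2<t_3<\dots$ be the positive solutions of $\cosh(t_k)\cos(t_k)=1$ and, for $k\ge2$ and $x\in[0,1]$, let $$\eta_k(x)=\cosh(t_kx)+\cos(t_kx)-\frac{\cosh(t_k)-\cos(t_k)}{\sinh(t_k)-\sin(t_k)}\big(\sinh(t_kx)+\sin(t_kx)\big).$$ Further, for $k\ge2$, let $\tilde t_k=\pi(2k-1)/2$ and $$\tilde\eta_k(x)=\sqrt2\cos\big(\tilde t_kx+\pi/4\big)+\mathbf 1_{[0,1/2]}(x)\exp\big(-\tilde t_kx\big)+\mathbf 1_{[1/2,1]}(x)(-1)^k\exp\big(-\tilde t_k(1-x)\big).$$ Then, for $\varepsilon>0$ and all $x\in[0,1]$, $|\eta_k(x)-\tilde\eta_k(x)|\le\varepsilon$ for $k\ge\frac2\pi\log(16/\varepsilon)+1$. In particular, the approximation $\tilde\eta_k$ is exact up to machine precision $\varepsilon=10^{-16}$ for $k\ge27$, i.e. $|\eta_k(x)-\tilde\eta_k(x)|\le10^{-16}$ for all $x\in[0,1]$ and $k\ge27$.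
   Context: $\mathbf 1_{E}$ denotes the indicator function of a set $E$; $\log$ is the natural logarithm. The index $k$ ranges over integers $k\ge2$. *)

(* Defs.v *)
From Stdlib Require Import Reals.
Open Scope R_scope.

(* [t 2 < t 3 < ...] lists exactly the positive solutions of
   [cosh s * cos s = 1]; the values [t 0] and [t 1] are irrelevant. *)
Definition enumerates_positive_solutions (t : nat -> R) : Prop :=
  (forall k : nat, (2 <= k)%nat -> t k < t (S k)) /\
  (forall s : R,
     (0 < s /\ cosh s * cos s = 1) <->
     (exists k : nat, (2 <= k)%nat /\ t k = s)).

Definition eta (t : nat -> R) (k : nat) (x : R) : R :=
  cosh (t k * x) + cos (t k * x)
  - (cosh (t k) - cos (t k)) / (sinh (t k) - sin (t k))
    * (sinh (t k * x) + sin (t k * x)).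

Definition t_tilde (k : nat) : R := PI * (2 * INR k - 1) / 2.

Definition indicator_Icc (a b x : R) : R :=
  if Rle_dec a x then (if Rle_dec x b then 1 else 0) else 0.

Definition eta_tilde (k : nat) (x : R) : R :=
  sqrt 2 * cos (t_tilde k * x + PI / 4)
  + indicator_Icc 0 (1 / 2) x * exp (- (t_tilde k * x))
  + indicator_Icc (1 / 2) 1 x * (-1) ^ k * exp (- (t_tilde k * (1 - x))).

(* Main.v *)
Require Import Defs.
From Stdlib Require Import Reals Lra Lia ZArith.
Open Scope R_scope.

(** The equation [cosh s * cos s = 1] can be solved up to an explicit,
    exponentially small correction.  Put [defect s = 2 atan (exp (- s))], the
    complement of the Gudermannian angle: its sine is [1 / cosh s] and its
    cosine is [tanh s].  The equation then reads [cos s = sin (defect s)], and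
    solving it trigonometrically shows that the positive solutions are the
    solutions of [s = t_tilde k + (-1) ^ k * defect s] for [k >= 2]
    ([positive_solution_iff]).  For each [k] this fixed-point equation has
    exactly one solution: one exists by the intermediate value theorem because
    [defect < PI / 2], and it is unique because [s - defect s] and
    [s + defect s] are both increasing.  These solutions increase with [k], and
    an increasing enumeration of a set is determined by the set, so the [k]-th
    solution is the one attached to [t_tilde k] ([enumeration_fixed_point]).
    In particular [|t k - t_tilde k| = defect (t k) <= 2 exp (- t k)].

    Knowing [sin (t k)] and [cos (t k)] exactly, the coefficient in [eta]
    becomes [(1 - c E) / (1 + c E)] with [c = (-1) ^ k] and [E = exp (- t k)],
    and the hyperbolic part collapses to
    [(exp (- t k x) + c exp (- t k (1 - x))) / (1 + c E)] ([eta_closed_form]);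
    no growing exponential is left.  Comparing term by term with [eta_tilde],
    everything is of order [E] except the exponentials cut off by the
    indicators, which are at most [sqrt E].  Hence the error is at most
    [8 exp (- t k / 2)], and [t k >= t_tilde k - 1 / 4] turns this into
    [16 exp (- (k - 1) PI / 2)] ([eta_error_exp]), which is at most [eps] for
    the stated [k].  For the machine-precision claim it remains to check
    [ln (16 * 10 ^ 16) <= 40 <= 13 PI]. *)

(** * Numerical constants and elementary estimates *)

Lemma PI_gt_3 : 3 < PI.
Proof. pose proof PI2_3_2; lra. Qed.

(* Sixteen terms of the Leibniz series undershoot [PI] by about 1/16. *)
Lemma PI_ge_40_13 : 40 / 13 <= PI.
Proof.
destruct (PI_ineq 7) as [H _].
unfold tg_alt, PI_tg in H; simpl in H; lra.
Qed.

Lemma exp_INR (n : nat) (y : R) : exp (INR n * y) = exp y ^ n.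
Proof.
induction n as [|n IH].
- simpl; rewrite Rmult_0_l; apply exp_0.
- rewrite S_INR; replace ((INR n + 1) * y) with (y + INR n * y) by ring.
  rewrite exp_plus, IH; reflexivity.
Qed.

Lemma exp_40_gt : 16 * 10 ^ 16 < exp 40.
Proof.
assert (He : 27 / 10 <= exp 1).
{ apply Rle_trans with ((1 + / 128) ^ 128).
  - lra.
  - replace (exp 1) with (exp (/ 128) ^ 128).
    + apply pow_incr; split; [lra | apply exp_ineq1_le].
    + rewrite <- exp_INR; f_equal; simpl; lra. }
apply Rlt_le_trans with ((27 / 10) ^ 40).
- lra.
- replace (exp 40) with (exp 1 ^ 40).
  + apply pow_incr; lra.
  + rewrite <- exp_INR; f_equal; simpl; lra.
Qed.

Lemma exp_le (x y : R) : x <= y -> exp x <= exp y.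
Proof.
intros [H | ->]; [left; apply exp_increasing; exact H | right; reflexivity].
Qed.

Lemma exp_neg_le_1 (x : R) : 0 <= x -> exp (- x) <= 1.
Proof. intros H; rewrite <- exp_0; apply exp_le; lra. Qed.

Lemma exp_neg_3 : exp (-3) <= / 8.
Proof.
replace (-3) with (Ropp 3) by lra.
rewrite exp_Ropp; apply Rinv_le_contravar; [lra|].
replace (exp 3) with (exp 1 ^ 3).
- pose proof (exp_ineq1_le 1).
  apply Rle_trans with (2 ^ 3); [lra | apply pow_incr; lra].
- rewrite <- exp_INR; f_equal; simpl; lra.
Qed.

Lemma Rabs_le_1_lipschitz (f f' : R -> R) :
  (forall c, derivable_pt_lim f c (f' c)) -> (forall c, Rabs (f' c) <= 1) ->
  forall a b, Rabs (f a - f b) <= Rabs (a - b).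
Proof.
intros Hd Hb.
assert (W : forall a b, a < b -> Rabs (f a - f b) <= Rabs (a - b)).
{ intros a b Hab.
  destruct (MVT_cor2 f f' a b Hab (fun c _ => Hd c)) as [c [Hc _]].
  rewrite (Rabs_minus_sym (f a)), (Rabs_minus_sym a), Hc, Rabs_mult.
  rewrite <- (Rmult_1_l (Rabs (b - a))) at 2.
  apply Rmult_le_compat_r; [apply Rabs_pos | apply Hb]. }
intros a b; destruct (Rtotal_order a b) as [H | [-> | H]].
- apply W, H.
- rewrite !Rminus_diag, Rabs_R0; lra.
- rewrite Rabs_minus_sym, (Rabs_minus_sym a); apply W, H.
Qed.

Lemma sin_lipschitz (a b : R) : Rabs (sin a - sin b) <= Rabs (a - b).
Proof.
apply (Rabs_le_1_lipschitz sin cos derivable_pt_lim_sin).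
intros c; apply Rabs_le, COS_bound.
Qed.

Lemma cos_lipschitz (a b : R) : Rabs (cos a - cos b) <= Rabs (a - b).
Proof.
apply (Rabs_le_1_lipschitz cos (fun c => - sin c) derivable_pt_lim_cos).
intros c; rewrite Rabs_Ropp; apply Rabs_le, SIN_bound.
Qed.

Lemma exp_neg_lipschitz (a b : R) :
  0 <= a -> 0 <= b -> Rabs (exp (- a) - exp (- b)) <= Rabs (a - b).
Proof.
assert (W : forall a b, 0 <= a -> a <= b ->
            Rabs (exp (- a) - exp (- b)) <= Rabs (a - b)).
{ clear a b; intros a b Ha Hab.
  rewrite (Rabs_minus_sym a), !Rabs_pos_eq; try lra.
  2: { pose proof (exp_le (- b) (- a)); lra. }
  replace (- b) with (- a + (a - b)) by ring; rewrite exp_plus.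
  pose proof (exp_ineq1_le (a - b)); pose proof (exp_neg_le_1 a Ha).
  pose proof (exp_pos (- a)); nra. }
intros Ha Hb; destruct (Rle_dec a b) as [H | H].
- apply W; assumption.
- rewrite Rabs_minus_sym, (Rabs_minus_sym a); apply W; lra.
Qed.

Lemma Rabs_le_interval (a b : R) : Rabs a <= b -> - b <= a <= b.
Proof.
intros H; pose proof (Rle_abs a); pose proof (Rle_abs (- a)) as H'.
rewrite Rabs_Ropp in H'; lra.
Qed.

Lemma pow_opp_1_cases (k : nat) : (-1) ^ k = 1 \/ (-1) ^ k = -1.
Proof.
induction k as [|k [H | H]]; simpl; [left | right | left]; try rewrite H; ring.
Qed.

(** * The angle measuring the distance to a zero of the cosine *)

Definition defect (s : R) : R := 2 * atan (exp (- s)).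

Lemma one_plus_exp_sq_pos (s : R) : 0 < 1 + exp (- s) * exp (- s).
Proof. pose proof (exp_pos (- s)); nra. Qed.

Lemma sin_defect (s : R) :
  sin (defect s) = 2 * exp (- s) / (1 + exp (- s) * exp (- s)).
Proof.
unfold defect; rewrite sin_2a, sin_atan, cos_atan; unfold Rsqr.
pose proof (one_plus_exp_sq_pos s) as H.
pose proof (sqrt_lt_R0 _ H).
rewrite <- (sqrt_sqrt (1 + exp (- s) * exp (- s))) at 3 by lra.
field; lra.
Qed.

Lemma cos_defect (s : R) :
  cos (defect s) =
  (1 - exp (- s) * exp (- s)) / (1 + exp (- s) * exp (- s)).
Proof.
unfold defect; rewrite cos_2a, sin_atan, cos_atan; unfold Rsqr.
pose proof (one_plus_exp_sq_pos s) as H.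
pose proof (sqrt_lt_R0 _ H).
rewrite <- (sqrt_sqrt (1 + exp (- s) * exp (- s))) at 5 by lra.
field; lra.
Qed.

Lemma cosh_mul_sin_defect (s : R) : cosh s * sin (defect s) = 1.
Proof.
rewrite sin_defect; unfold cosh.
pose proof (one_plus_exp_sq_pos s); pose proof (exp_pos (- s)).
replace (exp s) with (/ exp (- s)) by (rewrite <- exp_Ropp; f_equal; ring).
field; lra.
Qed.

Lemma defect_pos (s : R) : 0 < defect s.
Proof.
unfold defect; rewrite <- (Rmult_0_r 2); apply Rmult_lt_compat_l; [lra|].
rewrite <- atan_0; apply atan_increasing, exp_pos.
Qed.

Lemma defect_decreasing (a b : R) : a < b -> defect b < defect a.
Proof.
intros H; unfold defect; apply Rmult_lt_compat_l; [lra|].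
apply atan_increasing, exp_increasing; lra.
Qed.

Lemma defect_0 : defect 0 = PI / 2.
Proof. unfold defect; rewrite Ropp_0, exp_0, atan_1; field. Qed.

Lemma defect_lt_PI2 (s : R) : 0 < s -> defect s < PI / 2.
Proof. intros H; rewrite <- defect_0; apply defect_decreasing, H. Qed.

Lemma defect_lt_PI (s : R) : defect s < PI.
Proof. unfold defect; pose proof (atan_bound (exp (- s))); lra. Qed.

Lemma defect_le_exp (s : R) : defect s <= 2 * exp (- s).
Proof.
assert (H : Rabs (atan (exp (- s)) - atan 0) <= Rabs (exp (- s) - 0)).
{ apply (Rabs_le_1_lipschitz atan _ derivable_pt_lim_atan).
  intros c; pose proof (pow2_ge_0 c).
  rewrite Rabs_pos_eq.
  - rewrite <- Rinv_1; apply Rinv_le_contravar; lra.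
  - left; apply Rinv_0_lt_compat; lra. }
rewrite atan_0, !Rminus_0_r in H.
rewrite (Rabs_pos_eq (exp _)) in H by (left; apply exp_pos).
pose proof (Rle_abs (atan (exp (- s)))); unfold defect; lra.
Qed.

Lemma derivable_pt_lim_defect (s : R) :
  derivable_pt_lim defect s
    (2 * (/ (1 + exp (- s) ^ 2) * (exp (- s) * -1))).
Proof.
apply (derivable_pt_lim_scal (fun s => atan (exp (- s)))).
apply (derivable_pt_lim_comp (fun s => exp (- s)) atan).
2: apply derivable_pt_lim_atan.
apply (derivable_pt_lim_comp (fun s => - s) exp).
2: apply derivable_pt_lim_exp.
apply (derivable_pt_lim_opp id), derivable_pt_lim_id.
Qed.

(** The derivative of [defect] is [- / cosh], which lies above [-1] away
    from [0]. *)
Lemma plus_defect_increasing (a b : R) :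
  0 <= a -> a < b -> a + defect a < b + defect b.
Proof.
intros Ha Hab.
destruct (MVT_cor2 defect _ a b Hab (fun c _ => derivable_pt_lim_defect c))
  as [c [Hc [Hac Hcb]]].
assert (Hy : exp (- c) < 1) by (rewrite <- exp_0; apply exp_increasing; lra).
assert (Hd : -1 < 2 * (/ (1 + exp (- c) ^ 2) * (exp (- c) * -1))).
{ pose proof (one_plus_exp_sq_pos c).
  assert (0 < (1 - exp (- c)) ^ 2 / (1 + exp (- c) ^ 2)).
  { apply Rdiv_lt_0_compat; nra. }
  replace (2 * (/ (1 + exp (- c) ^ 2) * (exp (- c) * -1)))
    with (-1 + (1 - exp (- c)) ^ 2 / (1 + exp (- c) ^ 2)) by (field; nra).
  lra. }
nra.
Qed.

(** * Positive solutions as fixed points *)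

Lemma t_tilde_S (k : nat) : t_tilde (S k) = t_tilde k + PI.
Proof. unfold t_tilde; rewrite S_INR; field. Qed.

Lemma trig_t_tilde (k : nat) :
  sin (t_tilde k) = - (-1) ^ k /\ cos (t_tilde k) = 0.
Proof.
induction k as [|k [Hs Hc]].
- unfold t_tilde; simpl.
  replace (PI * (2 * 0 - 1) / 2) with (- (PI / 2)) by field.
  rewrite sin_neg, cos_neg, sin_PI2, cos_PI2; split; ring.
- rewrite t_tilde_S, neg_sin, neg_cos, Hs, Hc; simpl; split; ring.
Qed.

Lemma t_tilde_ge (k : nat) : (2 <= k)%nat -> 3 * PI / 2 <= t_tilde k.
Proof.
intros Hk; apply le_INR in Hk; simpl in Hk.
unfold t_tilde; pose proof PI_gt_3; nra.
Qed.

Definition fixed_point_of_index (k : nat) (s : R) : Prop :=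
  s = t_tilde k + (-1) ^ k * defect s.

Lemma fixed_point_pos (k : nat) (s : R) :
  (2 <= k)%nat -> fixed_point_of_index k s -> 0 < s.
Proof.
unfold fixed_point_of_index; intros Hk Hs.
pose proof (t_tilde_ge k Hk); pose proof (defect_lt_PI s).
pose proof (defect_pos s); pose proof PI_gt_3.
destruct (pow_opp_1_cases k) as [E | E]; rewrite E in Hs; lra.
Qed.

Lemma trig_fixed_point (k : nat) (s : R) :
  fixed_point_of_index k s ->
  cos s = sin (defect s) /\ sin s = - (-1) ^ k * cos (defect s).
Proof.
intros Hs; destruct (trig_t_tilde k) as [Es Ec].
unfold fixed_point_of_index in Hs.
assert (E1 : cos s = cos (t_tilde k + (-1) ^ k * defect s)) by congruence.
assert (E2 : sin s = sin (t_tilde k + (-1) ^ k * defect s)) by congruence.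
rewrite E1, E2, cos_plus, sin_plus, Es, Ec.
destruct (pow_opp_1_cases k) as [E | E]; rewrite E.
- rewrite !Rmult_1_l; split; ring.
- replace (-1 * defect s) with (- defect s) by ring.
  rewrite sin_neg, cos_neg; split; ring.
Qed.

Lemma fixed_point_increasing (k : nat) (a b : R) :
  0 <= a -> a < b -> a - (-1) ^ k * defect a < b - (-1) ^ k * defect b.
Proof.
intros Ha Hab; pose proof (defect_decreasing a b Hab).
pose proof (plus_defect_increasing a b Ha Hab).
destruct (pow_opp_1_cases k) as [E | E]; rewrite E; lra.
Qed.

Lemma fixed_point_unique (k : nat) (a b : R) :
  (2 <= k)%nat -> fixed_point_of_index k a -> fixed_point_of_index k b ->
  a = b.
Proof.
intros Hk Ha Hb.
pose proof (fixed_point_pos k a Hk Ha); pose proof (fixed_point_pos k b Hk Hb).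
unfold fixed_point_of_index in Ha, Hb.
destruct (Rtotal_order a b) as [L | [L | L]]; [|exact L|].
- pose proof (fixed_point_increasing k a b); lra.
- pose proof (fixed_point_increasing k b a); lra.
Qed.

(** On [t_tilde k - PI / 2, t_tilde k + PI / 2] the defect stays below
    [PI / 2], so [s - t_tilde k - (-1) ^ k * defect s] changes sign. *)
Lemma fixed_point_exists (k : nat) :
  (2 <= k)%nat -> {s : R | fixed_point_of_index k s}.
Proof.
intros Hk.
pose proof (t_tilde_ge k Hk) as HT; pose proof PI_gt_3 as HPI.
assert (Hc : continuity (fun s => s - t_tilde k - (-1) ^ k * defect s)).
{ apply continuity_minus.
  - apply continuity_minus.
    + apply derivable_continuous, derivable_id.
    + apply continuity_const; intros ? ?; reflexivity.
  - apply continuity_scal, derivable_continuous.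
    intros s; eexists; apply derivable_pt_lim_defect. }
destruct (IVT_cor _ (t_tilde k - PI / 2) (t_tilde k + PI / 2) Hc)
  as [s [_ Hs]].
- lra.
- pose proof (defect_lt_PI2 (t_tilde k - PI / 2)).
  pose proof (defect_lt_PI2 (t_tilde k + PI / 2)).
  pose proof (defect_pos (t_tilde k - PI / 2)).
  pose proof (defect_pos (t_tilde k + PI / 2)).
  destruct (pow_opp_1_cases k) as [E | E]; rewrite E; nra.
- exists s; unfold fixed_point_of_index; lra.
Qed.

(** For the direct implication, [sin s = - c * cos (defect s)] for a sign [c],
    so [s - c * defect s] is a zero of the cosine at which the sine is [- c];
    such a zero is [t_tilde k] for an integer [k] with [(-1) ^ k = c].
    Positivity of [s] excludes [k <= 0], and also [k = 1], where
    [s + defect s = PI / 2] has no solution but [0]. *)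
Lemma positive_solution_iff (s : R) :
  (0 < s /\ cosh s * cos s = 1) <->
  (exists k : nat, (2 <= k)%nat /\ fixed_point_of_index k s).
Proof.
split.
- intros [Hs Heq].
  assert (Hcos : cos s = sin (defect s)).
  { apply Rmult_eq_reg_l with (cosh s).
    - rewrite Heq, cosh_mul_sin_defect; reflexivity.
    - intros E; rewrite E in Heq; lra. }
  assert (Hsin : exists c, (c = 1 \/ c = -1) /\ sin s = - c * cos (defect s)).
  { assert (E : (sin s - cos (defect s)) * (sin s + cos (defect s)) = 0).
    { pose proof (sin2_cos2 s) as H1; pose proof (sin2_cos2 (defect s)) as H2.
      unfold Rsqr in *; rewrite Hcos in H1; lra. }
    destruct (Rmult_integral _ _ E); [exists (-1) | exists 1]; lra. }
  destruct Hsin as [c [Hc Hsin]].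
  assert (Htrig : cos (s - c * defect s) = 0 /\ sin (s - c * defect s) = - c).
  { rewrite cos_minus, sin_minus, Hcos, Hsin.
    pose proof (sin2_cos2 (defect s)) as H; unfold Rsqr in H.
    destruct Hc as [-> | ->].
    - rewrite Rmult_1_l; split; nra.
    - replace (-1 * defect s) with (- defect s) by ring.
      rewrite sin_neg, cos_neg; split; nra. }
  destruct Htrig as [H0 H1].
  destruct (cos_eq_0_0 _ H0) as [j Hj].
  pose proof PI_gt_3 as HPI; pose proof (defect_lt_PI2 s Hs) as Hd.
  pose proof (plus_defect_increasing 0 s (Rle_refl 0) Hs) as Hinc.
  rewrite defect_0 in Hinc.
  assert (Hj0 : (0 <= j)%Z).
  { assert (L : IZR (-1) < IZR j) by (destruct Hc as [-> | ->]; nra).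
    apply lt_IZR in L; lia. }
  assert (Et : s - c * defect s = t_tilde (Z.to_nat (j + 1))).
  { rewrite Hj; unfold t_tilde.
    rewrite INR_IZR_INZ, Z2Nat.id, plus_IZR by lia; field. }
  assert (Ec : (-1) ^ Z.to_nat (j + 1) = c).
  { pose proof (proj1 (trig_t_tilde (Z.to_nat (j + 1)))) as E.
    rewrite <- Et, H1 in E; lra. }
  exists (Z.to_nat (j + 1)); split.
  + assert (j <> 0)%Z.
    { intros ->; simpl in Ec, Hj; destruct Hc as [-> | ->]; lra. }
    lia.
  + unfold fixed_point_of_index; rewrite <- Et, Ec; ring.
- intros [k [Hk Hfix]]; split.
  + exact (fixed_point_pos k s Hk Hfix).
  + destruct (trig_fixed_point k s Hfix) as [-> _]; apply cosh_mul_sin_defect.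
Qed.

(** * Identification of the enumeration *)

Lemma increasing_from (n0 : nat) (u : nat -> R) :
  (forall k, (n0 <= k)%nat -> u k < u (S k)) ->
  forall i j, (n0 <= i)%nat -> (i < j)%nat -> u i < u j.
Proof.
intros Hu i j Hi Hij; induction Hij as [|j Hij IH].
- apply Hu, Hi.
- apply Rlt_trans with (u j); [exact IH | apply Hu; lia].
Qed.

Lemma increasing_enumeration_le (n0 n : nat) (u v : nat -> R) :
  (forall k, (n0 <= k)%nat -> u k < u (S k)) ->
  (forall k, (n0 <= k)%nat -> v k < v (S k)) ->
  (forall k, (n0 <= k)%nat -> exists j, (n0 <= j)%nat /\ v j = u k) ->
  (n0 <= n)%nat ->
  (forall j, (n0 <= j)%nat -> (j < n)%nat -> u j = v j) -> v n <= u n.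
Proof.
intros Hu Hv Huv Hn Hbelow.
destruct (Huv n Hn) as [j [Hj Ej]].
destruct (Nat.lt_trichotomy j n) as [L | [<- | L]].
- pose proof (increasing_from n0 u Hu j n Hj L).
  rewrite (Hbelow j Hj L) in H; lra.
- lra.
- pose proof (increasing_from n0 v Hv n j Hn L); lra.
Qed.

Lemma increasing_enumeration_unique (n0 : nat) (u v : nat -> R) :
  (forall k, (n0 <= k)%nat -> u k < u (S k)) ->
  (forall k, (n0 <= k)%nat -> v k < v (S k)) ->
  (forall k, (n0 <= k)%nat -> exists j, (n0 <= j)%nat /\ v j = u k) ->
  (forall k, (n0 <= k)%nat -> exists j, (n0 <= j)%nat /\ u j = v k) ->
  forall k, (n0 <= k)%nat -> u k = v k.
Proof.
intros Hu Hv Huv Hvu k.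
induction k as [k IH] using (well_founded_induction lt_wf); intros Hk.
apply Rle_antisym.
- apply (increasing_enumeration_le n0 k v u); auto.
  intros j Hj L; symmetry; auto.
- apply (increasing_enumeration_le n0 k u v); auto.
Qed.

(** The fixed point of index [k] lies within [PI / 2] of [t_tilde k], and
    consecutive [t_tilde k] differ by [PI]. *)
Lemma fixed_point_index_lt (k : nat) (a b : R) :
  (2 <= k)%nat -> fixed_point_of_index k a -> fixed_point_of_index (S k) b ->
  a < b.
Proof.
intros Hk Ha Hb.
assert (Hk' : (2 <= S k)%nat) by lia.
pose proof (defect_lt_PI2 a (fixed_point_pos k a Hk Ha)).
pose proof (defect_lt_PI2 b (fixed_point_pos (S k) b Hk' Hb)).
pose proof (defect_pos a); pose proof (defect_pos b).
unfold fixed_point_of_index in Ha, Hb; rewrite t_tilde_S in Hb.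
simpl in Hb.
destruct (pow_opp_1_cases k) as [E | E]; rewrite E in Ha, Hb; lra.
Qed.

Lemma enumeration_fixed_point (t : nat -> R) :
  enumerates_positive_solutions t ->
  forall k, (2 <= k)%nat -> fixed_point_of_index k (t k).
Proof.
intros [Hinc Hsol].
set (r := fun k => match le_dec 2 k with
                   | left H => proj1_sig (fixed_point_exists k H)
                   | right _ => 0
                   end).
assert (Hr : forall k, (2 <= k)%nat -> fixed_point_of_index k (r k)).
{ intros k Hk; unfold r; destruct (le_dec 2 k) as [H | H]; [|lia].
  exact (proj2_sig (fixed_point_exists k H)). }
intros k Hk; rewrite (increasing_enumeration_unique 2 t r); auto.
- intros i Hi; apply (fixed_point_index_lt i); auto.
- intros i Hi.
  destruct (proj1 (positive_solution_iff (t i))) as [j [Hj Ej]].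
  + apply Hsol; exists i; auto.
  + exists j; split; [exact Hj|].
    apply (fixed_point_unique j); auto.
- intros i Hi; apply Hsol, positive_solution_iff; exists i; auto.
Qed.

(** * The approximation error *)

(** Substituting the exact values of [sin s] and [cos s] at a solution cancels
    the growing exponential: with [E = exp (- s)] the coefficient is
    [(1 - c E) / (1 + c E)]. *)
Lemma eta_closed_form (t : nat -> R) (k : nat) (x : R) :
  (2 <= k)%nat -> fixed_point_of_index k (t k) ->
  let c := (-1) ^ k in
  let E := exp (- t k) in
  eta t k x =
  cos (t k * x) - (1 - c * E) / (1 + c * E) * sin (t k * x)
  + (exp (- (t k * x)) + c * exp (- (t k * (1 - x)))) / (1 + c * E).
Proof.
intros Hk Hfix c E; unfold eta.
destruct (trig_fixed_point k (t k) Hfix) as [-> ->].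
rewrite sin_defect, cos_defect; unfold sinh, cosh.
assert (Hpos := fixed_point_pos k (t k) Hk Hfix).
assert (HE : 0 < E < 1).
{ split; [apply exp_pos | unfold E; rewrite <- exp_0].
  apply exp_increasing; lra. }
assert (E1 : exp (t k) = / E) by (unfold E; rewrite exp_Ropp, Rinv_inv; auto).
assert (E2 : exp (- (t k * (1 - x))) = E * exp (t k * x)).
{ unfold E; rewrite <- exp_plus; f_equal; ring. }
rewrite E1, E2; fold E c.
assert (Hc : c = 1 \/ c = -1) by apply pow_opp_1_cases.
assert (H1 : 1 - E * E <> 0) by nra.
assert (H2 : 1 + E * E <> 0) by nra.
assert (Hcoef :
  ((/ E + E) / 2 - 2 * E / (1 + E * E)) /
  ((/ E - E) / 2 - - c * ((1 - E * E) / (1 + E * E))) =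
  (1 - c * E) / (1 + c * E)).
{ assert (Hden : (/ E - E) / 2 - - c * ((1 - E * E) / (1 + E * E)) =
                 (1 - E * E) * ((1 + c * E) * (1 + c * E))
                 / (2 * E * (1 + E * E))).
  { destruct Hc as [-> | ->]; field; lra. }
  assert (Hnum : (/ E + E) / 2 - 2 * E / (1 + E * E) =
                 (1 - E * E) * (1 - E * E) / (2 * E * (1 + E * E))).
  { field; lra. }
  rewrite Hden, Hnum.
  destruct Hc as [-> | ->]; field; repeat split; lra. }
rewrite Hcoef.
destruct Hc as [-> | ->]; field; lra.
Qed.

(** Each exponential of [eta] is compared with its truncated counterpart: where
    the indicator is [1] only the frequency differs, and where it is [0] the
    exponent is below [- s / 2]. *)
Lemma exp_truncation_error (s T u : R) :
  0 <= s -> 0 <= T -> 0 <= u <= 1 ->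
  Rabs (exp (- (s * u)) - indicator_Icc 0 (1 / 2) u * exp (- (T * u)))
  <= Rabs (s - T) + exp (- (s / 2)).
Proof.
intros Hs HT Hu; unfold indicator_Icc.
destruct (Rle_dec 0 u) as [_ | H]; [|lra].
destruct (Rle_dec u (1 / 2)) as [H | H].
- rewrite Rmult_1_l.
  assert (Rabs (s * u - T * u) <= Rabs (s - T)).
  { rewrite <- Rmult_minus_distr_r, Rabs_mult, (Rabs_pos_eq u) by lra.
    pose proof (Rabs_pos (s - T)); nra. }
  pose proof (exp_neg_lipschitz (s * u) (T * u)).
  pose proof (exp_pos (- (s / 2))); nra.
- rewrite Rmult_0_l, Rminus_0_r, Rabs_pos_eq by (left; apply exp_pos).
  pose proof (Rabs_pos (s - T)).
  pose proof (exp_le (- (s * u)) (- (s / 2))); nra.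
Qed.

Lemma indicator_upper_half (x : R) :
  indicator_Icc (1 / 2) 1 x = indicator_Icc 0 (1 / 2) (1 - x).
Proof.
unfold indicator_Icc.
repeat match goal with |- context [Rle_dec ?a ?b] => destruct (Rle_dec a b) end;
  lra.
Qed.

Lemma sqrt2_cos_shift (y : R) : sqrt 2 * cos (y + PI / 4) = cos y - sin y.
Proof.
rewrite cos_plus, cos_PI4, sin_PI4.
pose proof (sqrt_lt_R0 2); field; lra.
Qed.

Lemma Rabs_mult_le (a b A B : R) :
  Rabs a <= A -> Rabs b <= B -> Rabs (a * b) <= A * B.
Proof.
intros Ha Hb; rewrite Rabs_mult.
apply Rmult_le_compat; auto using Rabs_pos.
Qed.

Lemma eta_error_sqrt (t : nat -> R) (k : nat) (x : R) :
  (2 <= k)%nat -> fixed_point_of_index k (t k) -> 0 <= x <= 1 ->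
  exp (- t k) <= / 8 ->
  Rabs (eta t k x - eta_tilde k x) <= 8 * exp (- (t k / 2)).
Proof.
intros Hk Hfix Hx HE8.
rewrite (eta_closed_form t k x Hk Hfix); unfold eta_tilde.
rewrite sqrt2_cos_shift, indicator_upper_half.
pose proof (fixed_point_pos k (t k) Hk Hfix) as Hpos.
assert (HT : 0 <= t_tilde k).
{ pose proof (t_tilde_ge k Hk); pose proof PI_gt_3; lra. }
assert (Hdist : Rabs (t k - t_tilde k) <= 2 * exp (- t k)).
{ unfold fixed_point_of_index in Hfix.
  pose proof (defect_le_exp (t k)); pose proof (defect_pos (t k)).
  apply Rabs_le.
  destruct (pow_opp_1_cases k) as [E | E]; rewrite E in Hfix; lra. }
assert (Hdistx : Rabs (t k * x - t_tilde k * x) <= 2 * exp (- t k)).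
{ rewrite <- Rmult_minus_distr_r, Rabs_mult, (Rabs_pos_eq x) by lra.
  pose proof (Rabs_pos (t k - t_tilde k)); nra. }
pose proof (cos_lipschitz (t k * x) (t_tilde k * x)) as Bcos.
pose proof (sin_lipschitz (t k * x) (t_tilde k * x)) as Bsin.
assert (Hx' : 0 <= 1 - x <= 1) by lra.
assert (Hs : 0 <= t k) by lra.
pose proof (exp_truncation_error (t k) (t_tilde k) x Hs HT Hx) as B0.
pose proof (exp_truncation_error (t k) (t_tilde k) (1 - x) Hs HT Hx') as B1.
assert (Hsq : exp (- t k) = exp (- (t k / 2)) * exp (- (t k / 2))).
{ rewrite <- exp_plus; f_equal; field. }
assert (Ba : Rabs (exp (- (t k * x))) <= 1).
{ rewrite Rabs_pos_eq by (left; apply exp_pos); apply exp_neg_le_1; nra. }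
assert (Bb : Rabs (exp (- (t k * (1 - x)))) <= 1).
{ rewrite Rabs_pos_eq by (left; apply exp_pos); apply exp_neg_le_1; nra. }
assert (Bs : Rabs (sin (t k * x)) <= 1) by apply Rabs_le, SIN_bound.
pose proof (exp_pos (- (t k / 2))) as Hp.
set (p := exp (- (t k / 2))) in *.
set (E := exp (- t k)) in *.
set (c := (-1) ^ k).
assert (Hc : c = 1 \/ c = -1) by apply pow_opp_1_cases.
assert (HE0 : 0 < E) by apply exp_pos.
assert (Bc : Rabs c <= 1) by (destruct Hc as [-> | ->]; apply Rabs_le; lra).
assert (Bq : Rabs (c * E / (1 + c * E)) <= 8 / 7 * E).
{ unfold Rdiv at 1; rewrite (Rmult_comm (8 / 7)); rewrite Rmult_assoc.
  rewrite <- (Rmult_1_l (E * (8 / 7))).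
  apply Rabs_mult_le; [exact Bc|].
  apply Rabs_mult_le; [rewrite Rabs_pos_eq; lra|].
  rewrite Rabs_pos_eq.
  - replace (8 / 7) with (/ (7 / 8)) by field.
    apply Rinv_le_contravar; destruct Hc as [-> | ->]; lra.
  - left; apply Rinv_0_lt_compat; destruct Hc as [-> | ->]; lra. }
set (a := exp (- (t k * x))) in *.
set (b := exp (- (t k * (1 - x)))) in *.
set (q := c * E / (1 + c * E)) in *.
set (a' := indicator_Icc 0 (1 / 2) x * exp (- (t_tilde k * x))) in *.
set (b' := indicator_Icc 0 (1 / 2) (1 - x) * exp (- (t_tilde k * (1 - x)))) in *.
assert (Hsplit :
  cos (t k * x) - (1 - c * E) / (1 + c * E) * sin (t k * x)
  + (a + c * b) / (1 + c * E)
  - (cos (t_tilde k * x) - sin (t_tilde k * x) + a'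
     + indicator_Icc 0 (1 / 2) (1 - x) * c * exp (- (t_tilde k * (1 - x)))) =
  (cos (t k * x) - cos (t_tilde k * x))
  - (sin (t k * x) - sin (t_tilde k * x))
  + 2 * (q * sin (t k * x)) + (a - a') + c * (b - b') - q * a - q * (c * b)).
{ unfold q, b'; field; destruct Hc as [-> | ->]; lra. }
rewrite Hsplit.
pose proof (Rabs_mult_le _ _ _ _ Bq Bs) as C1.
pose proof (Rabs_mult_le _ _ _ _ Bc B1) as C2.
pose proof (Rabs_mult_le _ _ _ _ Bq Ba) as C3.
pose proof (Rabs_mult_le _ _ _ _ Bq (Rabs_mult_le _ _ _ _ Bc Bb)) as C4.
(* The terms of order [E] add up to [(8 + 32 / 7) E], the others to [2 p];
   since [E = p ^ 2 <= 1 / 8], [p] is below [2 / 5]. *)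
assert (Hp2 : p <= 2 / 5) by nra.
assert (HEp : E <= 2 / 5 * p) by nra.
clear - Bcos Bsin B0 C1 C2 C3 C4 HEp Hdist Hdistx Hp.
apply Rabs_le.
apply (fun h => Rle_trans _ _ _ h Hdistx) in Bcos.
apply (fun h => Rle_trans _ _ _ h Hdistx) in Bsin.
apply Rabs_le_interval in Bcos, Bsin.
apply Rabs_le_interval in B0, C1, C2, C3, C4.
lra.
Qed.

Lemma eta_error_exp (t : nat -> R) (k : nat) (x : R) :
  enumerates_positive_solutions t -> (2 <= k)%nat -> 0 <= x <= 1 ->
  Rabs (eta t k x - eta_tilde k x) <= 16 * exp (- ((INR k - 1) * PI / 2)).
Proof.
intros Ht Hk Hx.
pose proof (enumeration_fixed_point t Ht k Hk) as Hfix.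
pose proof (defect_lt_PI2 _ (fixed_point_pos k (t k) Hk Hfix)) as Hd.
pose proof (t_tilde_ge k Hk); pose proof PI_gt_3.
pose proof (defect_pos (t k)).
assert (Hlow : t_tilde k - defect (t k) <= t k).
{ unfold fixed_point_of_index in Hfix.
  destruct (pow_opp_1_cases k) as [E | E]; rewrite E in Hfix; lra. }
assert (HE8 : exp (- t k) <= / 8).
{ apply Rle_trans with (exp (-3)); [apply exp_le; lra | apply exp_neg_3]. }
pose proof (defect_le_exp (t k)).
(* [t_tilde k / 2 = (k - 1) * PI / 2 + PI / 4], and the defect is at most 1/4. *)
assert (Hhalf : exp (- (t k / 2)) <= exp (- ((INR k - 1) * PI / 2))).
{ apply exp_le; unfold t_tilde in Hlow; lra. }
pose proof (eta_error_sqrt t k x Hk Hfix Hx HE8).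
pose proof (exp_pos (- (t k / 2))); lra.
Qed.

Theorem theorem4p3 (t : nat -> R) (ht : enumerates_positive_solutions t) :
  (forall (eps : R) (k : nat) (x : R),
     0 < eps -> (2 <= k)%nat -> 0 <= x <= 1 ->
     INR k >= 2 / PI * ln (16 / eps) + 1 ->
     Rabs (eta t k x - eta_tilde k x) <= eps) /\
  (forall (k : nat) (x : R),
     (27 <= k)%nat -> 0 <= x <= 1 ->
     Rabs (eta t k x - eta_tilde k x) <= / 10 ^ 16).
Proof.
assert (Main : forall (eps : R) (k : nat) (x : R),
     0 < eps -> (2 <= k)%nat -> 0 <= x <= 1 ->
     INR k >= 2 / PI * ln (16 / eps) + 1 ->
     Rabs (eta t k x - eta_tilde k x) <= eps).
{ intros eps k x Heps Hk Hx Hln.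
  apply Rle_trans with (1 := eta_error_exp t k x ht Hk Hx).
  pose proof PI_gt_3 as HPI.
  assert (Hq : 0 < 16 / eps) by (apply Rdiv_lt_0_compat; lra).
  assert (L : ln (16 / eps) <= (INR k - 1) * PI / 2).
  { replace (ln (16 / eps)) with (2 / PI * ln (16 / eps) * (PI / 2))
      by (field; lra).
    nra. }
  apply exp_le in L; rewrite exp_ln in L by exact Hq.
  rewrite exp_Ropp.
  pose proof (exp_pos ((INR k - 1) * PI / 2)).
  apply Rmult_le_reg_r with (exp ((INR k - 1) * PI / 2)); [assumption|].
  rewrite Rmult_assoc, Rinv_l, Rmult_1_r by lra.
  apply Rmult_le_compat_l with (r := eps) in L; [|lra].
  replace (eps * (16 / eps)) with 16 in L by (field; lra); exact L. }
split; [exact Main|].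
intros k x Hk Hx; apply Main; auto; [lra | lia |].
replace (16 / / 10 ^ 16) with (16 * 10 ^ 16) by (field; lra).
assert (L : ln (16 * 10 ^ 16) <= 40).
{ rewrite <- (ln_exp 40); left; apply ln_increasing; [lra | apply exp_40_gt]. }
pose proof PI_ge_40_13 as HPI.
apply le_INR in Hk; rewrite (INR_IZR_INZ 27) in Hk; simpl in Hk.
assert (2 / PI * ln (16 * 10 ^ 16) <= 26).
{ apply Rmult_le_reg_r with (PI / 2); [lra|].
  replace (2 / PI * ln (16 * 10 ^ 16) * (PI / 2)) with (ln (16 * 10 ^ 16))
    by (field; lra).
  lra. }
lra.
Qed.
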